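(* Let $\mathbb{X},\mathbb{Y}$ be real Hilbert spaces and let $T:\mathbb{X}\to\mathbb{Y}$ be an injective bounded linear operator. Let $\kappa:[0,\infty)\to[0,\infty)$ be an index function such that $t\mapsto\kappa(t)^2/t^{1-\mu}$ is decreasing for some $\mu\in(0,1)$ and $\kappa\cdot\kappa$ is concave. Define the index function $$\psi_\kappa(t):=\kappa\big(\Theta_\kappa^{-1}(\sqrt t)\big)^2,\qquad \Theta_\kappa(\lambda):=\sqrt\lambda\,\kappa(\lambda).$$ Then the following statements for $f^\dagger\in\mathbb{X}$ are equivalent: (i) $f^\dagger$ satisfies a variational source condition with $\psi(t)=A\psi_\kappa(t)$ for some $A>0$. (ii) $\|f^\dagger\|_{\mathbb{X}^T_\kappa}<\infty$. More precisely, (i) implies $$\|E_\lambda f^\dagger\|\le\sqrt{\tfrac{2A}{3}}\;\kappa\big(\tfrac{2A}{3}\lambda\big)\le\sqrt{\tfrac{2A}{3}}\max\Big(1,\sqrt{\tfrac{2A}{3}}\Big)\kappa(\lambda)\quad\text{for all }\lambda>0.$$ Vice versa, if $\kappa$ is normalized such that $\|f^\dagger\|_{\mathbb{X}^T_\kappa}=1$, then (i) holds true with $$A=2(1+\mu^{-1})+2\kappa(\|T\|^2)\sup_{t\in(0,4\|T\|\,\|f^\dagger\|]}\frac{\sqrt t}{\psi_\kappa(t)},$$ and this $A$ is finite.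
   Context: An index function is a continuous, strictly monotonically increasing function $\psi:[0,\infty)\to[0,\infty)$ with $\psi(0)=0$. $f^\dagger$ satisfies a variational source condition with $\psi$ if $2\langle f^\dagger,f^\dagger-f\rangle_{\mathbb{X}}\le\frac12\|f-f^\dagger\|_{\mathbb{X}}^2+\psi(\|Tf-Tf^\dagger\|_{\mathbb{Y}}^2)$ for all $f\in\mathbb{X}$. $E_\lambda:=\chi_{[0,\lambda]}(T^*T)$, $\lambda\ge0$, are the spectral projections of $T^*T$, and $\|f\|_{\mathbb{X}^T_\kappa}:=\sup_{\lambda>0}\frac{1}{\kappa(\lambda)}\|E_\lambda f\|_{\mathbb{X}}$, $\mathbb{X}^T_\kappa:=\{f\in\mathbb{X}:\|f\|_{\mathbb{X}^T_\kappa}<\infty\}$. *)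

(* Defs.v *)
From HB Require Import structures.
From mathcomp Require Import all_boot all_order all_algebra.
From mathcomp Require Import all_classical all_reals all_analysis.
Set Implicit Arguments.
Unset Strict Implicit.
Unset Printing Implicit Defensive.
Import Order.TTheory GRing.Theory Num.Theory.
Import numFieldNormedType.Exports.

Local Open Scope classical_set_scope.
Local Open Scope ring_scope.

HB.mixin Record CompleteNormedModule_isHilbert (R : realType) (X : Type)
    of CompleteNormedModule R X := {
  inner : X -> X -> R ;
  innerC : forall x y, inner x y = inner y x ;
  innerPl : forall (a : R) x y z,
    inner (a *: x + y) z = a * inner x z + inner y z ;
  inner_norm : forall x, inner x x = `|x| ^+ 2 }.

#[short(type="hilbertType")]
HB.structure Definition Hilbert (R : realType) :=
  {X of CompleteNormedModule_isHilbert R X & CompleteNormedModule R X}.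

Section operators.
Context {R : realType}.

(* For bounded linear [T], Riesz representation shows that the set below is a
   singleton for every [y]; the default value [0] is then never used. *)
Definition adjoint {X Y : hilbertType R} (T : X -> Y) (y : Y) : X :=
  xget 0 [set x | forall z, inner z x = inner (T z) y].

Definition opnorm {X Y : normedModType R} (T : X -> Y) : R :=
  sup [set `|T x| | x in [set x | `|x| <= 1]].

Record orthogonal_projection {X : hilbertType R} (P : X -> X) : Prop := {
  oproj_linear : linear P ;
  oproj_idem : forall x, P (P x) = P x ;
  oproj_sym : forall x y, inner (P x) y = inner x (P y) }.

(* [measurableTypeR R] is the real line with its Borel sigma-algebra; the
   values of [E] at non-Borel sets are irrelevant. *)
Record projection_valued_measure {X : hilbertType R}
    (E : set (measurableTypeR R) -> X -> X) : Prop := {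
  pvm_proj : forall B, measurable B -> orthogonal_projection (E B) ;
  pvm_setT : forall x, E setT x = x ;
  pvm_setI : forall B C, measurable B -> measurable C ->
    forall x, E (B `&` C) x = E B (E C x) ;
  pvm_sigma_additive : forall F : nat -> set (measurableTypeR R),
    (forall n, measurable (F n)) -> trivIset setT F ->
    forall x, series (fun n => E (F n) x) @ \oo --> E (\bigcup_n F n) x }.

(* [E] is the spectral measure of the bounded self-adjoint operator [A], so that
   chi_B(A) = E B: it has bounded support and A = int t dE(t), i.e.
   <Ax, x> = int t d<E(t)x, x> for all x, which determines [A] because [A] is
   symmetric.  By the spectral theorem such an [E] exists and it is unique on
   Borel sets. *)
Record spectral_measure {X : hilbertType R} (A : X -> X)
    (E : set (measurableTypeR R) -> X -> X) : Prop := {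
  spectral_pvm : projection_valued_measure E ;
  spectral_bounded : exists M : R, forall x, E `[- M, M]%classic x = x ;
  spectral_integral : forall x,
    exists2 m : {measure set (measurableTypeR R) -> \bar R},
      forall B, measurable B -> m B = (inner (E B x) x)%:E &
      ((inner (A x) x)%:E = \int[m]_t t%:E)%E }.

Definition spectral_projection {X : hilbertType R}
    (E : set (measurableTypeR R) -> X -> X) (lambda : R) : X -> X :=
  E `[0, lambda]%classic.

End operators.

Section index_functions.
Context {R : realType}.
Implicit Types psi kappa : R -> R.

(* Functions on [0, oo) are represented by functions on [R], whose values at
   negative arguments are irrelevant. *)
Record index_function psi : Prop := {
  index_ge0 : forall t, 0 <= t -> 0 <= psi t ;
  index_continuous : {within `[0, +oo[, continuous psi} ;
  index_increasing : {in `[0, +oo[ &, {homo psi : s t / s < t}} ;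
  index_0 : psi 0 = 0 }.

Definition Theta kappa (lambda : R) : R := Num.sqrt lambda * kappa lambda.

Definition psi_of kappa (t : R) : R :=
  kappa ('pinv_(fun=> 0) `[0, +oo[ (Theta kappa) (Num.sqrt t)) ^+ 2.

Definition variational_source_condition {X Y : hilbertType R} (T : X -> Y)
    (fdag : X) psi : Prop :=
  forall f : X, 2 * inner fdag (fdag - f) <=
    2^-1 * `|f - fdag| ^+ 2 + psi (`|T f - T fdag| ^+ 2).

Definition source_norm {X : hilbertType R}
    (E : set (measurableTypeR R) -> X -> X) kappa (f : X) : \bar R :=
  ereal_sup [set ((kappa lambda)^-1 * `|spectral_projection E lambda f|)%:E
            | lambda in `]0, +oo[%classic].

Definition vsc_constant {X Y : hilbertType R} (T : X -> Y) kappa (mu : R)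
    (fdag : X) : \bar R :=
  let S := ereal_sup [set (Num.sqrt t / psi_of kappa t)%:E
                     | t in `]0, 4 * opnorm T * `|fdag|]%classic] in
  ((2 * (1 + mu^-1))%:E + (2 * kappa (opnorm T ^+ 2))%:E * S)%E.

End index_functions.

(* Main.v *)
(* (i) => (ii): testing the source condition with f = (I - E_lambda) fdag gives
   3/2 |E_lambda fdag|^2 <= A psi_kappa(lambda |E_lambda fdag|^2); unwinding Theta
   yields the bound.

   (ii) => (i): suppose |E_lambda fdag| <= N kappa(lambda).  Let g = fdag - f and
   choose lambda with Theta(lambda) = |T g|, so that
   kappa(lambda)^2 = psi_kappa(|T g|^2).  The low frequencies satisfy
   2 <E_lambda fdag, g> <= |g|^2 / 2 + 2 N^2 kappa(lambda)^2.  The high frequencies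
   are cut into dyadic blocks, on which |T g|^2 controls |g|^2; the decay of
   kappa^2 / t^(1 - mu) gives kappa(2 t)^2 <= (2 - mu) kappa(t)^2, and the resulting
   geometric sum is at most 1 / mu^2.  For N = 1 this already proves (i) with
   A = 2 (1 + 1 / mu), so the supremum in the stated constant only has to be
   finite and nonnegative. *)

Require Import Defs.
From HB Require Import structures.
From mathcomp Require Import all_boot all_order all_algebra.
From mathcomp Require Import all_classical all_reals all_analysis.
From mathcomp Require Import measurable_realfun ring lra.
Set Implicit Arguments.
Unset Strict Implicit.
Unset Printing Implicit Defensive.
Import Order.TTheory GRing.Theory Num.Theory.
Import numFieldNormedType.Exports.
Local Open Scope classical_set_scope.
Local Open Scope ring_scope.

(** * Inner product algebra and the Cauchy-Schwarz inequality *)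

Section inner_product.
Context {R : realType} {X : hilbertType R}.
Implicit Types (x y z : X) (a : R).

Lemma innerDl x y z : inner (x + y) z = inner x z + inner y z.
Proof. by rewrite -[x in LHS]scale1r innerPl mul1r. Qed.

Lemma inner0l z : inner 0 z = 0.
Proof. by apply: (addrI (inner 0 z)); rewrite -innerDl !addr0. Qed.

Lemma innerZl a x z : inner (a *: x) z = a * inner x z.
Proof. by rewrite -[a *: x]addr0 innerPl inner0l addr0. Qed.

Lemma innerNl x z : inner (- x) z = - inner x z.
Proof. by rewrite -scaleN1r innerZl mulN1r. Qed.

Lemma innerBl x y z : inner (x - y) z = inner x z - inner y z.
Proof. by rewrite innerDl innerNl. Qed.

Lemma innerDr x y z : inner z (x + y) = inner z x + inner z y.
Proof. by rewrite innerC innerDl !(innerC z). Qed.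

Lemma inner0r z : inner z 0 = 0. Proof. by rewrite innerC inner0l. Qed.

Lemma innerZr a x z : inner z (a *: x) = a * inner z x.
Proof. by rewrite innerC innerZl (innerC z). Qed.

Lemma innerNr x z : inner z (- x) = - inner z x.
Proof. by rewrite innerC innerNl (innerC z). Qed.

Lemma normD_sqr x y : `|x + y| ^+ 2 = `|x| ^+ 2 + 2 * inner x y + `|y| ^+ 2.
Proof. by rewrite -!inner_norm innerDl !innerDr (innerC y x); ring. Qed.

(** The squared norm of |y| x - |x| y equals 2 |x| |y| (|x| |y| - <x, y>) and is nonnegative. *)
Lemma inner_le_norm x y : inner x y <= `|x| * `|y|.
Proof.
have [->|x0] := eqVneq x 0; first by rewrite inner0l normr0 mul0r.
have [->|y0] := eqVneq y 0; first by rewrite inner0r normr0 mulr0.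
have xy : 0 < `|x| * `|y| by rewrite mulr_gt0 ?normr_gt0.
have : 0 <= `| `|y| *: x + (- `|x|) *: y| ^+ 2 by rewrite sqr_ge0.
rewrite normD_sqr !normrZ normrN !normr_id innerZl innerZr => H.
rewrite -(ler_pM2l xy); nra.
Qed.

Lemma abs_inner_le x y : `|inner x y| <= `|x| * `|y|.
Proof.
have := inner_le_norm (- x) y; rewrite innerNl normrN => H.
by rewrite ler_norml lerNl H inner_le_norm.
Qed.

Lemma innerl_cvg (u : nat -> X) x y :
  u n @[n --> \oo] --> x -> inner (u n) y @[n --> \oo] --> inner x y.
Proof.
move=> /cvgrPdist_lt ux; apply/cvgrPdist_lt => e e0.
have y1 : 0 < `|y| + 1 by rewrite ltr_wpDl.
have ey : 0 < e / (`|y| + 1) by rewrite divr_gt0.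
near=> n; rewrite -innerBl (le_lt_trans (abs_inner_le _ _))//.
have : `|x - u n| < e / (`|y| + 1) by near: n; exact: ux.
rewrite ltr_pdivlMr// => /(le_lt_trans _); apply.
by rewrite ler_wpM2l// lerDl.
Unshelve. all: by end_near. Qed.

End inner_product.

(** * Riesz representation and the adjoint *)

Section riesz.
Context {R : realType} {X : hilbertType R}.
Variable phi : X -> R.
Hypothesis phiP : forall a x y, phi (a *: x + y) = a * phi x + phi y.

Let phi0 : phi 0 = 0.
Proof. by have := phiP 1 0 0; rewrite scaler0 addr0; lra. Qed.

(* Compare [u] with [u + s w] for the optimal [s = - (<u, w> - phi w) / |w|^2]. *)
Lemma minimizer_gradient (d e : R) (u w : X) :
  (forall z, d <= `|z| ^+ 2 - 2 * phi z) -> `|u| ^+ 2 - 2 * phi u <= d + e ->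
  (inner u w - phi w) ^+ 2 <= e * `|w| ^+ 2.
Proof.
move=> dmin ue; have [->|w0] := eqVneq w 0.
  by rewrite inner0r phi0 subr0 normr0 !expr0n mulr0.
have w2 : 0 < `|w| ^+ 2 by rewrite exprn_gt0 ?normr_gt0.
set D := inner u w - phi w; set s := - (D / `|w| ^+ 2).
have := dmin (u + s *: w).
have -> : phi (u + s *: w) = phi u + s * phi w by rewrite addrC phiP addrC.
rewrite normD_sqr innerZr normrZ exprMn real_normK ?num_real// => H.
have {H ue} : 0 <= e + 2 * s * D + s ^+ 2 * `|w| ^+ 2 by rewrite /D; lra.
have -> : e + 2 * s * D + s ^+ 2 * `|w| ^+ 2 = e - D ^+ 2 / `|w| ^+ 2.
  by rewrite /s; field; rewrite normr_eq0.
by rewrite subr_ge0 ler_pdivrMr.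
Qed.

(** A minimising sequence of |z|^2 - 2 phi z is Cauchy by the parallelogram law; at its limit, which
    exists by completeness, the gradient vanishes. *)
Lemma riesz_representation (C : R) :
  (forall x, phi x <= C * `|x|) -> exists u, forall w, inner u w = phi w.
Proof.
move=> phiC; pose J (z : X) : R := `|z| ^+ 2 - 2 * phi z.
have J_lb : has_inf (range J).
  split; first by exists (J 0), 0.
  (* Completing the square gives J z >= (|z| - C)^2 - C^2. *)
  exists (- C ^+ 2) => _ [z _ <-].
  have := phiC z; have := sqr_ge0 (`|z| - C); rewrite /J; nra.
set d := inf (range J).
have dJ z : d <= J z by apply: ge_inf; [exact: J_lb.2|exists z].
have /choice[u uP] n : exists z, J z <= d + n.+1%:R^-1.
  have n0 : 0 < n.+1%:R^-1 :> R by rewrite invr_gt0.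
  by have [_ [z _ <-] /ltW] := inf_adherent n0 J_lb; exists z.
(* Parallelogram law: J (u m) + J (u n) minus twice the value at the midpoint is |u m - u n|^2 / 2,
   and the midpoint value is at least d. *)
have uu m n : `|u m - u n| ^+ 2 <= 2 * (m.+1%:R^-1 + n.+1%:R^-1).
  have := dJ (2^-1 *: (u m + u n)); have := uP m; have := uP n.
  have phi_mid : phi (2^-1 *: (u m + u n)) =
      2^-1 * (phi (u m) + phi (u n)).
    by have := phiP 1 (u m) (u n); have := phiP 2^-1 (u m + u n) 0;
      rewrite scale1r !addr0 phi0; lra.
  rewrite /J phi_mid normrZ exprMn.
  rewrite (normD_sqr (u m) (- u n)) normrN (normD_sqr (u m)) innerNr.
  rewrite (@ger0_norm _ 2^-1) ?invr_ge0//.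
  by move: m.+1%:R^-1 n.+1%:R^-1 => a b ? ? ?; lra.
have ucvg : cvg (u n @[n --> \oo]).
  apply/cauchy_cvgP/cauchy_exP => e e0.
  have e4 : 0 < e ^+ 2 / 4 by rewrite divr_gt0 ?exprn_gt0.
  have small := near_infty_natSinv_lt (PosNum e4).
  have [N Ne] : exists N, N.+1%:R^-1 < e ^+ 2 / 4.
    by near \oo => N; exists N; near: N.
  exists (u N); change (\forall n \near \oo, ball (u N) e (u n)); near=> n.
  rewrite -ball_normE/= -(@ltr_pXn2r _ 2)// ?nnegrE// ?ltW//.
  rewrite (le_lt_trans (uu _ _))//.
  have -> : e ^+ 2 = 2 * (e ^+ 2 / 4 + e ^+ 2 / 4) by field.
  by rewrite ltr_pM2l// ltrD//; near: n.
pose l := lim (u n @[n --> \oo]); exists l => w; apply/eqP.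
rewrite -subr_eq0 -sqrf_eq0 eq_le sqr_ge0 andbT.
have grad n : (inner (u n) w - phi w) ^+ 2 <= n.+1%:R^-1 * `|w| ^+ 2.
  exact: minimizer_gradient dJ (uP n).
have inner_cvg : inner (u n) w @[n --> \oo] --> inner l w.
  exact: innerl_cvg ucvg.
have harm0 : n.+1%:R^-1 * `|w| ^+ 2 @[n --> \oo] --> (0 : R).
  by rewrite -[X in _ --> X](mul0r (`|w| ^+ 2)); exact: (cvgMr_tmp cvg_harmonic).
have grad_cvg : (inner (u n) w - phi w) ^+ 2 @[n --> \oo]
    --> (inner l w - phi w) ^+ 2.
  by apply: cvgM; apply: cvgB inner_cvg _; exact: cvg_cst.
by apply: (ler_cvg_to grad_cvg harm0); apply: nearW => n; exact: grad.
Unshelve. all: by end_near. Qed.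

End riesz.

(** The functional z |-> <T z, y> is bounded with constant C |y|, so Riesz representation excludes
    the default value of [xget]. *)
Lemma adjointP (R : realType) (X Y : hilbertType R) (T : {linear X -> Y}) :
  bounded_near T (nbhs 0) ->
  forall z y, inner z (adjoint T y) = inner (T z) y.
Proof.
move=> /linear_boundedP/pinfty_ex_gt0[C C0 TC] z y; rewrite /adjoint.
case: xgetP => [x _ ->//|no_adj]; exfalso.
have phiP a u v : inner (T (a *: u + v)) y = a * inner (T u) y + inner (T v) y.
  by rewrite linearP innerPl.
have [|x xP] := riesz_representation phiP (C := C * `|y|).
  move=> x; rewrite (le_trans (inner_le_norm _ _))// mulrAC.
  by rewrite ler_wpM2r.
by apply: (no_adj x) => u; rewrite innerC xP.
Qed.

(** * Projection-valued measures *)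

Section projection_valued_measure.
Context {R : realType} {X : hilbertType R}.
Variable E : set (measurableTypeR R) -> X -> X.
Hypothesis pvmE : projection_valued_measure E.
Implicit Types (B C : set (measurableTypeR R)) (x y : X).

Lemma pvmD B x y : measurable B -> E B (x + y) = E B x + E B y.
Proof.
by move=> /(pvm_proj pvmE)[EBl _ _]; have := EBl 1 x y; rewrite !scale1r.
Qed.

Lemma pvm_vec0 B : measurable B -> E B 0 = 0.
Proof. by move=> mB; apply: (addrI (E B 0)); rewrite -pvmD// !addr0. Qed.

Lemma pvm_inner B x y : measurable B -> inner (E B x) y = inner (E B x) (E B y).
Proof.
by move=> /(pvm_proj pvmE)[_ EBK EBsym]; rewrite -EBsym EBK.
Qed.

Lemma pvm_inner_norm B x : measurable B -> inner (E B x) x = `|E B x| ^+ 2.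
Proof. by move=> mB; rewrite pvm_inner// inner_norm. Qed.

(** Countable additivity on the constant sequence of empty sets makes a series with constant terms
    converge, so these terms are 0. *)
Lemma pvm_set0 x : E set0 x = 0.
Proof.
have ser := @pvm_sigma_additive _ _ _ pvmE (fun=> set0) (fun=> measurable0).
have /cvg_series_cvg_0 : cvgn (series (fun n : nat => E set0 x)).
  by apply/cvg_ex; eexists; apply: ser; apply/trivIsetP => *; rewrite setI0.
move=> /(cvg_unique (@norm_hausdorff _ X) (cvg_cst (E set0 x))); apply.
Qed.

(** Countable additivity for B, C followed by empty sets; the partial sums are constant from index 2
    on. *)
Lemma pvmU B C x : measurable B -> measurable C -> B `&` C = set0 ->
  E (B `|` C) x = E B x + E C x.
Proof.
move=> mB mC BC0.
have mF n : measurable (bigcup2 B C n).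
  by case: n => [|[|n]] //=; exact: measurable0.
have tF : trivIset setT (bigcup2 B C) by rewrite -trivIset_bigcup2.
have /(_ x) := @pvm_sigma_additive _ _ _ pvmE _ mF tF.
rewrite bigcup2E => /cvg_lim <-//.
apply: cvg_lim => //; apply: cvg_near_cst; near=> n.
rewrite /series/=; have n2 : (2 <= n)%N by near: n; exact: nbhs_infty_ge.
rewrite -(subnKC n2) addnC addn2 big_nat_recl// big_nat_recl//= big1 ?addr0//.
by move=> i _; rewrite pvm_set0.
Unshelve. all: by end_near. Qed.

Lemma pvm_disjoint B C x y : measurable B -> measurable C -> B `&` C = set0 ->
  inner (E B x) (E C y) = 0.
Proof.
move=> mB mC BC0; rewrite -(oproj_sym (pvm_proj pvmE mC)).
by rewrite -(pvm_setI pvmE)// setIC BC0 pvm_set0 inner0l.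
Qed.

Lemma pvm_sub B C x : measurable B -> measurable C -> B `<=` C ->
  E C (E B x) = E B x.
Proof.
by move=> mB mC /setIidr BC; rewrite -(pvm_setI pvmE)// BC.
Qed.

Lemma pvm_disjoint0 B C x : measurable B -> measurable C -> B `&` C = set0 ->
  E B (E C x) = 0.
Proof. by move=> mB mC BC; rewrite -(pvm_setI pvmE)// BC pvm_set0. Qed.

End projection_valued_measure.

(** * Spectral estimates for T *)

Section spectral.
Context {R : realType} {X Y : hilbertType R}.
Variables (T : {linear X -> Y}) (E : set (measurableTypeR R) -> X -> X).
Hypotheses (T_inj : injective T) (T_bounded : bounded_near T (nbhs 0)).
Hypothesis E_spectral : spectral_measure (adjoint T \o T) E.
Implicit Types (B C : set (measurableTypeR R)) (x y : X).

Let pvmE := spectral_pvm E_spectral.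

Let itv_neg_nneg :
  `[0%R, +oo[ `&` `]-oo, 0%R[ = set0 :> set (measurableTypeR R).
Proof.
rewrite -subset0 => t []/=.
by rewrite !in_itv/= andbT => /le_gtF ->.
Qed.

(** The adjoint identity turns the quadratic form into |T x|^2; cutting at 0 leaves an integrand of
    constant sign on each half-line. *)
Let spectral_integral_norm x :
  exists2 m : {measure set (measurableTypeR R) -> \bar R},
    forall B, measurable B -> m B = (inner (E B x) x)%:E &
    ((`|T x| ^+ 2)%:E = \int[m]_(t in `]-oo, 0%R[) t%:E +
                       \int[m]_(t in `[0%R, +oo[) t%:E)%E.
Proof.
have [m mE mint] := spectral_integral E_spectral x; exists m => //.
rewrite -integral_setU//; first last.
- by rewrite disj_set2E setIC; exact/eqP.
- have -> : `]-oo, 0%R[ `|` `[0%R, +oo[ = [set: measurableTypeR R].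
    apply/seteqP; split=> t//= _; rewrite !in_itv/= andbT.
    by case: (ltP t 0) => _; [left|right].
  by rewrite -mint/= innerC adjointP// inner_norm.
Qed.

(* On the range of [E ]-oo, 0[] the spectral integral of [|T z|^2] is nonpositive,
   so [T z = 0], and injectivity applies. *)
Lemma pvm_negative0 x : E `]-oo, 0%R[ x = 0.
Proof.
set z := E _ x; apply: T_inj; rewrite linear0; apply/eqP.
rewrite -normr_eq0 -sqrf_eq0 eq_le sqr_ge0 andbT -lee_fin.
have [m mE ->] := spectral_integral_norm z.
rewrite [X in (_ + X)%E]null_set_integral ?adde0//; last first.
  by rewrite mE// (pvm_disjoint0 pvmE)// ?inner0l//; exact: itv_neg_nneg.
rewrite (eq_integral (fun t : measurableTypeR R => - (- (t : R))%:E)%E);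
  last first.
  by move=> t _; rewrite EFinN oppeK.
have nneg (t : R) : `]-oo, 0%R[%classic t -> (0 <= (- t)%:E)%E.
  by rewrite /= in_itv/= lee_fin oppr_ge0 => /ltW.
by rewrite integral_ge0N// -[leRHS]/(0%E) oppe_le0 integral_ge0.
Qed.

(** The negative half-line has measure zero by [pvm_negative0]; the remaining integrand is
    nonnegative, so norm estimates follow by comparing integrals. *)
Lemma spectral_integral_nneg x :
  exists2 m : {measure set (measurableTypeR R) -> \bar R},
    forall B, measurable B -> m B = (`|E B x| ^+ 2)%:E &
    ((`|T x| ^+ 2)%:E = \int[m]_(t in `[0%R, +oo[) t%:E)%E.
Proof.
have [m mE mint] := spectral_integral_norm x; exists m => [B mB|].
  by rewrite mE// (pvm_inner_norm pvmE).
rewrite mint null_set_integral ?add0e//.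
by rewrite mE// pvm_negative0 inner0l.
Qed.

Let nneg_itv (t : R) : `[0%R, +oo[%classic t -> (0 <= t%:E)%E.
Proof. by rewrite /= in_itv/= andbT. Qed.

(** The measure of [E B x] gives B the mass |E B x|^2, the integrand is at least a on B, and
    discarding the rest of the half-line only lowers the integral. *)
Lemma spectral_norm_ge (a : R) B x : 0 <= a -> measurable B ->
  B `<=` `[a, +oo[ -> a * `|E B x| ^+ 2 <= `|T (E B x)| ^+ 2.
Proof.
move=> a0 mB Ba; rewrite -lee_fin.
have [m mE ->] := spectral_integral_nneg (E B x).
have B0 : B `<=` `[0, +oo[.
  by move=> t /Ba; rewrite /= !in_itv/= !andbT; exact: le_trans.
apply: (@le_trans _ _ (\int[m]_(t in B) a%:E)%E).
  by rewrite integral_cst// EFinM mE// (pvm_sub pvmE).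
apply: (@le_trans _ _ (\int[m]_(t in B) t%:E)%E).
  apply: ge0_le_integral => // t /Ba.
  by rewrite /= in_itv/= andbT lee_fin.
by apply: ge0_subset_integral.
Qed.

(** The measure of [E B x] vanishes outside B, so the whole integral lives where t <= b. *)
Lemma spectral_norm_le (b : R) B x : measurable B ->
  B `<=` `[0, b] -> `|T (E B x)| ^+ 2 <= b * `|E B x| ^+ 2.
Proof.
move=> mB Bb; rewrite -lee_fin.
have [m mE ->] := spectral_integral_nneg (E B x).
have mD : measurable (`[0, +oo[ `\` B : set (measurableTypeR R)).
  exact: measurableD.
rewrite (ge0_negligible_integral mD)//; last first.
  rewrite mE// (pvm_disjoint0 pvmE) ?normr0 ?expr0n//.
  by rewrite setDE -setIA setICl setI0.
have -> : `[0, +oo[ `\` (`[0, +oo[ `\` B) = B.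
  rewrite setDD setIidr// => t /Bb.
  by rewrite /= !in_itv/= andbT => /andP[].
apply: (@le_trans _ _ (\int[m]_(t in B) b%:E)%E).
  apply: ge0_le_integral => // t /Bb; rewrite /= in_itv/= lee_fin => /andP[] //.
by rewrite integral_cst// EFinM mE// (pvm_sub pvmE).
Qed.

(** Every [E D] keeps the two components orthogonal, so the measure of the sum is the sum of the
    measures and the integrals add. *)
Lemma spectral_pythagoras B C x : measurable B -> measurable C ->
  B `&` C = set0 ->
  `|T (E B x + E C x)| ^+ 2 = `|T (E B x)| ^+ 2 + `|T (E C x)| ^+ 2.
Proof.
move=> mB mC BC0; apply: EFin_inj; rewrite EFinD.
have [m mE ->] := spectral_integral_nneg (E B x + E C x).
have [m1 m1E ->] := spectral_integral_nneg (E B x).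
have [m2 m2E ->] := spectral_integral_nneg (E C x).
rewrite -ge0_integral_measure_add//.
apply: eq_measure_integral => D mD _.
rewrite mE// [RHS]measure_addE m1E// m2E// -EFinD (pvmD pvmE)// normD_sqr.
rewrite -!(pvm_setI pvmE)// (pvm_disjoint pvmE) ?mulr0 ?addr0//;
  try exact: measurableI.
by rewrite setIACA BC0 setI0.
Qed.

End spectral.

(** * Index functions *)

Section index_function_theory.
Context {R : realType}.
Implicit Types (f kappa : R -> R) (s t : R).

Lemma index_le f : index_function f ->
  {in `[0, +oo[ &, {mono f : s t / s <= t}}.
Proof. by case=> _ _ f_inc _; exact: le_mono_in. Qed.

Lemma index_gt0 f t : index_function f -> 0 < t -> 0 < f t.
Proof.
case=> _ _ f_inc f0 t0; rewrite -f0.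
by apply: f_inc => //; rewrite in_itv/= andbT ?lexx// ltW.
Qed.

Lemma index_IVT f b v : index_function f -> 0 <= b -> 0 <= v <= f b ->
  exists2 s, 0 <= s <= b & f s = v.
Proof.
move=> f_idx b0 vfb.
have f0b : f 0 <= f b by rewrite (index_le f_idx) ?in_itv/= ?andbT.
have [||s sb fs] := @IVT R f 0 b v b0.
- apply: continuous_subspaceW (index_continuous f_idx) => t /=.
  by rewrite !in_itv/= andbT => /andP[].
- by rewrite (min_idPl f0b) (max_idPr f0b) (index_0 f_idx).
by exists s; first by move: sb; rewrite in_itv.
Qed.

(* [psi_of] inherits surjectivity onto intervals from [kappa] and [Theta], which
   spares proving that the inverse of [Theta] is continuous. *)
Lemma inc_surj_within_continuous f :
  {in `[0, +oo[ &, {homo f : s t / s < t}} ->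
  (forall b, 0 <= b -> set_surj `[0, b] `[f 0, f b] f) ->
  {within `[0, +oo[, continuous f}.
Proof.
move=> f_inc f_surj.
have fb_cont b : 0 <= b -> {within `[0, b], continuous f}.
  move=> b0; apply: segment_inc_surj_continuous (f_surj b b0).
  apply: sub_in2 (le_mono_in f_inc) => t.
  by rewrite !in_itv/= andbT => /andP[].
apply/continuous_within_itvcyP; split.
  move=> t; rewrite in_itv/= andbT => t0.
  apply: (@within_continuous_continuous _ _ _ 0 (t + 1)).
  - by rewrite ltr_wpDl// ltW.
  - by apply: fb_cont; rewrite ltW// ltr_wpDl// ltW.
  - by rewrite in_itv/= t0 ltrDl ltr01.
by have /continuous_within_itvP-/(_ ltr01)[] := fb_cont 1 ler01.
Qed.

(** * The functions [Theta] and [psi_of] *)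

Section Theta.
Variable kappa : R -> R.
Hypothesis kappa_idx : index_function kappa.

Lemma index_function_Theta : index_function (Theta kappa).
Proof.
split.
- by move=> t t0; rewrite mulr_ge0 ?sqrtr_ge0// (index_ge0 kappa_idx).
- move=> t; apply: cvgM; last exact: (index_continuous kappa_idx).
  by apply: continuous_subspaceT; exact: sqrt_continuous.
- move=> s t s0 t0 st; have k := index_increasing kappa_idx s0 t0 st.
  move: s0 t0; rewrite !in_itv/= !andbT => s0 t0.
  have t_gt0 : 0 < t := le_lt_trans s0 st.
  (* Strictness must come from [kappa], with the positive factor sqrt t, because kappa s is 0 when s
     = 0. *)
  apply: (@le_lt_trans _ _ (Num.sqrt t * kappa s)).
    by rewrite ler_wpM2r ?(index_ge0 kappa_idx)// ler_wsqrtr// ltW.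
  by rewrite ltr_pM2l// sqrtr_gt0.
- by rewrite /Theta sqrtr0 mul0r.
Qed.

Let Theta_idx := index_function_Theta.

Let Theta_ge1 t : 1 <= t -> Num.sqrt t * kappa 1 <= Theta kappa t.
Proof.
move=> t1; rewrite /Theta ler_wpM2l ?sqrtr_ge0//.
by rewrite (index_le kappa_idx) ?in_itv/= ?andbT// (le_trans _ t1).
Qed.

Lemma Theta_surj : set_surj `[0, +oo[ `[0, +oo[ (Theta kappa).
Proof.
move=> v; rewrite /= in_itv/= andbT => v0.
have k1 : 0 < kappa 1 by rewrite (index_gt0 kappa_idx).
(* Chosen so that b >= 1 and sqrt b * kappa 1 >= v. *)
set b := 1 + (v / kappa 1) ^+ 2.
have b1 : 1 <= b by rewrite lerDl sqr_ge0.
have b0 : 0 <= b by rewrite (le_trans _ b1).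
have [|s /andP[s0 _] <-] := @index_IVT _ b v Theta_idx b0.
  rewrite v0 (le_trans _ (Theta_ge1 b1))// -ler_pdivrMr//.
  have -> : v / kappa 1 = Num.sqrt ((v / kappa 1) ^+ 2).
    by rewrite sqrtr_sqr ger0_norm// divr_ge0// ltW.
  by rewrite ler_wsqrtr// lerDr.
by exists s => //=; rewrite in_itv/= andbT.
Qed.

(** The parametrisation t = Theta(s)^2 removes the inverse of [Theta] from all later arguments; it
    rests on the injectivity of [Theta] on the half-line. *)
Lemma psi_of_Theta s : 0 <= s ->
  psi_of kappa (Theta kappa s ^+ 2) = kappa s ^+ 2.
Proof.
move=> s0; rewrite /psi_of sqrtr_sqr ger0_norm ?(index_ge0 Theta_idx)//.
rewrite pinvKV ?inE/= ?in_itv/= ?andbT// => x y /set_mem x0 /set_mem y0.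
exact: (inc_inj_in (index_le Theta_idx)).
Qed.

Lemma Theta_sqr_surj t : 0 <= t -> exists2 s, 0 <= s & t = Theta kappa s ^+ 2.
Proof.
move=> t0; have [|s] := @Theta_surj (Num.sqrt t).
  by rewrite /= in_itv/= andbT sqrtr_ge0.
by rewrite /= in_itv/= andbT => s0 Ts; exists s; rewrite // Ts sqr_sqrtr.
Qed.

Lemma index_function_psi_of : index_function (psi_of kappa).
Proof.
have psi0 : psi_of kappa 0 = 0.
  have := psi_of_Theta (lexx 0).
  by rewrite (index_0 Theta_idx) (index_0 kappa_idx) expr0n.
have psi_inc : {in `[0, +oo[ &, {homo psi_of kappa : s t / s < t}}.
  move=> t1 t2; rewrite !in_itv/= !andbT.
  move=> /Theta_sqr_surj[s1 s10 ->] /Theta_sqr_surj[s2 s20 ->].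
  rewrite !psi_of_Theta// !ltr_pXn2r ?nnegrE ?(index_ge0 Theta_idx)//
    ?(index_ge0 kappa_idx)//.
  rewrite (leW_mono_in (index_le Theta_idx)) ?in_itv/= ?andbT//.
  by rewrite (leW_mono_in (index_le kappa_idx)) ?in_itv/= ?andbT.
split => //.
- by move=> t /Theta_sqr_surj[s s0 ->]; rewrite psi_of_Theta// sqr_ge0.
apply: inc_surj_within_continuous => // _ /Theta_sqr_surj[s s0 ->] v.
rewrite psi0 psi_of_Theta//= in_itv/= => /andP[v0 vs].
(* First solve kappa(u)^2 = v; then Theta(u)^2 is the preimage of v under [psi_of]. *)
have [|u /andP[u0 us] uv] := @index_IVT _ s (Num.sqrt v) kappa_idx s0.
  rewrite sqrtr_ge0/= -(ler_pXn2r (ltn0Sn 1)) ?nnegrE ?sqrtr_ge0//.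
    by rewrite sqr_sqrtr.
  exact: index_ge0.
exists (Theta kappa u ^+ 2); last by rewrite psi_of_Theta// uv sqr_sqrtr.
rewrite /= in_itv/= sqr_ge0 ler_pXn2r ?nnegrE ?(index_ge0 Theta_idx)//.
by rewrite (index_le Theta_idx) ?in_itv/= ?andbT.
Qed.

End Theta.

(** * Growth of kappa^2 and dyadic sums *)

Section growth.
Variables (kappa : R -> R) (mu : R).
Hypotheses (mu_gt0 : 0 < mu) (mu_lt1 : mu < 1).
Hypothesis kappa_decr : {in `]0, +oo[ &,
  nonincreasing_fun (fun t => kappa t ^+ 2 / t `^ (1 - mu))}.

Lemma index_growth c t : 1 <= c -> 0 < t ->
  kappa (c * t) ^+ 2 <= c `^ (1 - mu) * kappa t ^+ 2.
Proof.
move=> c1 t0; have c0 : 0 < c by rewrite (lt_le_trans _ c1).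
have ct0 : 0 < c * t by rewrite mulr_gt0.
have := @kappa_decr t (c * t).
rewrite !in_itv/= !andbT => /(_ t0 ct0); rewrite ler_pMl// => /(_ c1).
rewrite powRM ?(ltW c0) ?(ltW t0)// invfM mulrA.
rewrite ler_pM2r ?invr_gt0 ?powR_gt0// ler_pdivrMr ?powR_gt0//.
by rewrite [leRHS]mulrC.
Qed.

(** Weakens c^(1 - mu) to c; used for rescaling the argument of [kappa] and for the monotonicity of
    sqrt t / psi(t). *)
Lemma index_sublinear c t : 1 <= c -> 0 < t ->
  kappa (c * t) ^+ 2 <= c * kappa t ^+ 2.
Proof.
move=> c1 t0; rewrite (le_trans (index_growth c1 t0))// ler_wpM2r ?sqr_ge0//.
by rewrite -[leRHS]powRr1 ?(le_trans _ c1)// ler_powR// gerBl ltW.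
Qed.

(** Bounding 2^(1 - mu) by 2 - mu gives the later geometric sum the explicit ratio 1 - mu / 2. *)
Lemma index_doubling t : 0 < t -> kappa (2 * t) ^+ 2 <= (2 - mu) * kappa t ^+ 2.
Proof.
move=> t0; rewrite (le_trans (index_growth _ t0)) ?ler1n// ler_wpM2r ?sqr_ge0//.
have mu1 : 0 < 1 - mu by rewrite subr_gt0.
(* Young's inequality with exponents [1 / (1 - mu)] and [1 / mu]. *)
have := @conjugate_powR _ (2 `^ (1 - mu)) 1 (1 - mu)^-1 mu^-1.
rewrite !invr_gt0 !invrK -powRrM mulfV ?gt_eqF// powRr1// powR1 powR_ge0 subrK.
by move=> /(_ isT ler01 mu1 mu_gt0 erefl) H; lra.
Qed.

Lemma index_doubling_iter t n : 0 < t ->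
  kappa (t * 2 ^+ n) ^+ 2 <= kappa t ^+ 2 * (2 - mu) ^+ n.
Proof.
move=> t0; elim: n => [|n IHn]; first by rewrite !mulr1.
rewrite [2 ^+ _.+1]exprSr mulrA [_ * 2]mulrC.
rewrite (le_trans (index_doubling _)) ?mulr_gt0 ?exprn_gt0//.
rewrite [(2 - mu) ^+ n.+1]exprS [leRHS]mulrCA ler_wpM2l//.
by rewrite subr_ge0 (le_trans (ltW mu_lt1))// ler1n.
Qed.

End growth.
End index_function_theory.

(* Summation by parts turns the sum into [\sum_j F j / 2 ^+ j] plus boundary
   terms, a geometric sum of ratio [1 - mu / 2] bounded by [2 / mu - 1]. *)
Lemma dyadic_sum_le (R : realFieldType) (mu K : R) (F : nat -> R) n :
  0 < mu -> mu < 1 ->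
  (forall j, 0 <= F j) -> (forall j, F j <= K * (2 - mu) ^+ j) ->
  \sum_(j < n) (F j.+1 - F j) / 2 ^+ j <= K / mu ^+ 2.
Proof.
move=> mu0 mu1 F0 FK.
have K0 : 0 <= K by have := FK 0; rewrite mulr1; exact: le_trans.
pose r := 1 - mu / 2; have r0 : 0 <= r by rewrite /r; lra.
have bK j : F j / 2 ^+ j <= K * r ^+ j.
  rewrite ler_pdivrMr ?exprn_gt0// -mulrA -exprMn.
  by have -> : r * 2 = 2 - mu by rewrite /r; field.
case: n => [|n]; first by rewrite big_ord0 divr_ge0// sqr_ge0.
(* Since 1 - r = mu / 2, the first term is K times the sum of r^j over 1 <= j <= n; the second is
   the boundary term of the summation by parts. *)
have S : \sum_(j < n.+1) (F j.+1 - F j) / 2 ^+ j <=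
    K * (r - r ^+ n.+1) * (2 / mu) + 2 * (F n.+1 / 2 ^+ n.+1).
  elim: n => [|n IHn].
    rewrite big_ord1 /= expr0 !expr1 subrr mulr0 mul0r add0r divr1.
    by have := F0 0; lra.
  rewrite big_ord_recr/= (le_trans (lerD IHn (lexx _)))//.
  have b_n := bK n.+1.
  have -> : (F n.+2 - F n.+1) / 2 ^+ n.+1 =
      2 * (F n.+2 / 2 ^+ n.+2) - F n.+1 / 2 ^+ n.+1.
    by rewrite [2 ^+ n.+2]exprS; field; rewrite expf_neq0.
  have -> : K * (r - r ^+ n.+2) * (2 / mu) =
      K * (r - r ^+ n.+1) * (2 / mu) + K * r ^+ n.+1.
    by rewrite [r ^+ n.+2]exprS /r; field; rewrite gt_eqF.
  lra.
rewrite (le_trans S)// (le_trans (lerD (lexx _) (ler_wpM2l _ (bK _))))//.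
have rn : 0 <= r ^+ n.+1 by rewrite exprn_ge0.
rewrite ler_pdivlMr ?exprn_gt0//.
have -> : (K * (r - r ^+ n.+1) * (2 / mu) + 2 * (K * r ^+ n.+1)) * mu ^+ 2 =
    K * (r * 2 * mu - r ^+ n.+1 * (2 * mu * (1 - mu))).
  by field; rewrite gt_eqF.
(* The term with r^(n+1) is subtracted and nonnegative, and 2 r mu = 1 - (1 - mu)^2 <= 1. *)
rewrite ler_piMr// (le_trans (y := r * 2 * mu)) ?gerBl ?mulr_ge0//;
  rewrite ?/r; nra.
Qed.

(** * Variational source condition and spectral decay *)

Section variational_source_condition.
Context {R : realType} {X Y : hilbertType R}.
Variables (T : {linear X -> Y}) (E : set (measurableTypeR R) -> X -> X).
Hypotheses (T_inj : injective T) (T_bounded : bounded_near T (nbhs 0)).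
Hypothesis E_spectral : spectral_measure (adjoint T \o T) E.
Variables (kappa : R -> R) (mu : R).
Hypothesis kappa_idx : index_function kappa.
Hypotheses (mu_gt0 : 0 < mu) (mu_lt1 : mu < 1).
Hypothesis kappa_decr : {in `]0, +oo[ &,
  nonincreasing_fun (fun t => kappa t ^+ 2 / t `^ (1 - mu))}.
Implicit Types (f g : X) (lambda : R).

Let pvmE := spectral_pvm E_spectral.

(** For c >= M the complement of [0, c] meets the support bound [-M, M] only in negative numbers,
    where E vanishes. *)
Lemma spectral_projection_eventually_id f :
  exists M, forall c, M <= c -> spectral_projection E c f = f.
Proof.
have [M EM] := spectral_bounded E_spectral; exists M => c Mc.
have mC : measurable (~` `[0, c] : set (measurableTypeR R)).
  by apply: measurableC; exact: measurable_itv.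
have mM : measurable (`[- M, M] : set (measurableTypeR R)).
  exact: measurable_itv.
rewrite -[in RHS](pvm_setT pvmE f) -(setUv `[0, c]) (pvmU pvmE) ?setICr//.
rewrite -[in X in _ = _ + X](EM f) -(pvm_setI pvmE)//.
set B := _ `&` _; have mB : measurable B by exact: measurableI.
have Bneg : B `<=` `]-oo, 0[.
  move=> t []/=; rewrite !in_itv/= => /negP; rewrite negb_and -!ltNge.
  by move=> /orP[//|ct] /andP[_ tM]; move: ct; rewrite ltNge (le_trans tM Mc).
rewrite -(pvm_sub pvmE _ mB _ Bneg)//.
by rewrite (pvm_negative0 T_inj T_bounded E_spectral) addr0.
Qed.

(* Test the source condition with [f - E_lambda f]. *)
Lemma vsc_spectral_projection_le f A lambda : 0 < A ->
  variational_source_condition T f (fun t => A * psi_of kappa t) ->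
  0 < lambda -> `|spectral_projection E lambda f| <=
    Num.sqrt (2 * A / 3) * kappa (2 * A / 3 * lambda).
Proof.
move=> A0 vsc lambda0; rewrite /spectral_projection; set Ef := E _ f.
have c0 : 0 < 2 * A / 3 by rewrite divr_gt0// mulr_gt0.
have kc0 : 0 <= kappa (2 * A / 3 * lambda).
  by rewrite (index_ge0 kappa_idx)// ltW// mulr_gt0.
have TEf : `|T Ef| ^+ 2 <= lambda * `|Ef| ^+ 2.
  exact: (spectral_norm_le T_inj T_bounded E_spectral).
have fEf : inner f Ef = `|Ef| ^+ 2 by rewrite innerC (pvm_inner_norm pvmE).
have := vsc (f - Ef); rewrite -(linearB T) subKr fEf.
have -> : f - Ef - f = - Ef by rewrite addrAC subrr add0r.
rewrite linearN !normrN => vscE.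
have lEf0 : 0 <= lambda * `|Ef| ^+ 2 by rewrite mulr_ge0 ?sqr_ge0// ltW.
have [s s0 sE] := Theta_sqr_surj kappa_idx lEf0.
(* The test leaves 2 |Ef|^2 - |Ef|^2 / 2 on the left, whence the factor 2 A / 3. *)
have Ef_le : `|Ef| ^+ 2 <= 2 * A / 3 * kappa s ^+ 2.
  have := index_le (index_function_psi_of kappa_idx).
  move=> /(_ (`|T Ef| ^+ 2) (lambda * `|Ef| ^+ 2)).
  rewrite !in_itv/= !andbT sqr_ge0 lEf0 TEf => /(_ isT isT).
  rewrite sE psi_of_Theta// => /esym; rewrite -(ler_pM2l A0) => psiA.
  lra.
have [s_eq0|s_neq0] := eqVneq s 0.
  rewrite s_eq0 (index_0 kappa_idx) expr0n mulr0 in Ef_le.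
  have -> : `|Ef| = 0 by apply/eqP; rewrite -sqrf_eq0 eq_le Ef_le sqr_ge0.
  by rewrite mulr_ge0 ?sqrtr_ge0.
have s_gt0 : 0 < s by rewrite lt_def s_neq0.
have ks0 : 0 < kappa s by rewrite (index_gt0 kappa_idx).
(* Here s kappa(s)^2 = lambda |Ef|^2; insert [Ef_le] and cancel kappa(s)^2. *)
have s_le : s <= 2 * A / 3 * lambda.
  rewrite -(ler_pM2r (exprn_gt0 2 ks0)) [2 * A / 3 * lambda]mulrC -[leRHS]mulrA.
  move: sE; rewrite exprMn sqr_sqrtr// => <-.
  by rewrite ler_wpM2l // ltW.
rewrite -(@ler_pXn2r _ 2) ?nnegrE ?mulr_ge0 ?sqrtr_ge0//.
rewrite exprMn sqr_sqrtr ?(ltW c0)// (le_trans Ef_le)// ler_wpM2l ?(ltW c0)//.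
rewrite ler_pXn2r ?nnegrE ?(ltW ks0)// (index_le kappa_idx)//.
all: by rewrite in_itv/= andbT ?s0// mulr_ge0 ?ltW.
Qed.

(** For c <= 1 this is monotonicity; otherwise kappa(c lambda)^2 <= c kappa(lambda)^2. *)
Lemma index_scale_le c lambda : 0 < c -> 0 < lambda ->
  kappa (c * lambda) <= Num.max 1 (Num.sqrt c) * kappa lambda.
Proof.
move=> c0 lambda0; have kl := index_gt0 kappa_idx lambda0.
have [c1|/ltW c1] := leP c 1.
  apply: (@le_trans _ _ (kappa lambda)).
    rewrite (index_le kappa_idx) ?in_itv/= ?andbT;
      rewrite ?mulr_ge0 ?(ltW c0) ?(ltW lambda0)//.
    by rewrite ler_piMl// ltW.
  by rewrite ler_peMl ?(ltW kl)// le_max lexx.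
apply: (@le_trans _ _ (Num.sqrt c * kappa lambda)).
  rewrite -(@ler_pXn2r _ 2) ?nnegrE ?mulr_ge0 ?sqrtr_ge0 ?(ltW kl)//; last first.
    by rewrite (index_ge0 kappa_idx)// mulr_ge0 ?ltW.
  by rewrite exprMn sqr_sqrtr ?(ltW c0)// (index_sublinear mu_gt0 kappa_decr).
by rewrite ler_wpM2r ?(ltW kl)// le_max lexx orbT.
Qed.

(* Dyadic substitute for Cauchy-Schwarz between [(T^*T)^(-1/2) (I - E_lambda) f]
   and [(T^*T)^(1/2) g]: on the block [lambda 2^j < t <= lambda 2^(j+1)], [|T g|^2]
   dominates [lambda 2^j |g|^2]. *)
Lemma spectral_tail_le f g lambda K : 0 < lambda ->
  (forall j, `|spectral_projection E (lambda * 2 ^+ j) f| ^+ 2 <=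
     K * (2 - mu) ^+ j) ->
  2 * inner (f - spectral_projection E lambda f) g <=
    mu^-1 * (K + `|T g| ^+ 2 / lambda).
Proof.
move=> lambda0 FK; pose l (j : nat) := lambda * 2 ^+ j.
have l0 j : 0 < l j by rewrite mulr_gt0 ?exprn_gt0.
have ll j : l j <= l j.+1.
  by rewrite ler_pM2l// ler_eXn2l ?ltr1n.
pose F j := `|E `[0, l j] f| ^+ 2; pose G j := `|T (E `[0, l j] g)| ^+ 2.
pose B j : set (measurableTypeR R) := `]l j, l j.+1]%classic.
have disj j : `[0, l j] `&` B j = set0.
  rewrite -subset0 => t []; rewrite /B/= !in_itv/= => /andP[_ tl] /andP[lt _].
  by have := le_lt_trans tl lt; rewrite ltxx.
have itv_split j : `[0, l j.+1]%classic = `[0, l j]%classic `|` B j.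
  by apply: itv_bndbnd_setU; rewrite bnd_simp// ltW.
have mI j : measurable (`[0, l j] : set (measurableTypeR R)).
  exact: measurable_itv.
have mB j : measurable (B j) by exact: measurable_itv.
have ES j x : E `[0, l j.+1] x = E `[0, l j] x + E (B j) x.
  by rewrite itv_split (pvmU pvmE).
have FS j : F j.+1 - F j = `|E (B j) f| ^+ 2.
  rewrite /F ES normD_sqr (pvm_disjoint pvmE)// mulr0 addr0; lra.
have GS j : l j * `|E (B j) g| ^+ 2 <= G j.+1 - G j.
  rewrite /G ES (spectral_pythagoras T_inj T_bounded E_spectral)// addrAC subrr.
  rewrite add0r; apply: (spectral_norm_ge T_inj T_bounded E_spectral) => //.
    exact: ltW.
  by move=> t; rewrite /B/= !in_itv/= andbT => /andP[/ltW].
have step j : 2 * inner (E (B j) f) g <=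
    mu * ((F j.+1 - F j) / 2 ^+ j) + (lambda * mu)^-1 * (G j.+1 - G j).
  rewrite (pvm_inner pvmE)// FS.
  (* Young's inequality 2 |a| |b| <= |a|^2 / p + p |b|^2; this p gives both terms the same factor 1
     / mu after summation. *)
  set a := E (B j) f; set b := E (B j) g; pose p := 2 ^+ j / mu.
  have p0 : 0 < p by rewrite divr_gt0 ?exprn_gt0.
  have -> : mu * (`|a| ^+ 2 / 2 ^+ j) = p^-1 * `|a| ^+ 2.
    by rewrite /p; field; rewrite expf_neq0// gt_eqF.
  have pb : p * `|b| ^+ 2 <= (lambda * mu)^-1 * (G j.+1 - G j).
    have -> : p * `|b| ^+ 2 = (lambda * mu)^-1 * (l j * `|b| ^+ 2).
      by rewrite /p /l; field; rewrite !gt_eqF.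
    by rewrite ler_wpM2l ?GS// invr_ge0 ltW// mulr_gt0.
  have := inner_le_norm a b.
  have : 0 <= p^-1 * (`|a| - p * `|b|) ^+ 2.
    by rewrite mulr_ge0 ?sqr_ge0// invr_ge0 ltW.
  have -> : p^-1 * (`|a| - p * `|b|) ^+ 2 =
      p^-1 * `|a| ^+ 2 - 2 * (`|a| * `|b|) + p * `|b| ^+ 2.
    by field; rewrite gt_eqF.
  move: pb; move: ((lambda * mu)^-1 * _) (p^-1 * _) => ? ? ? ? ?; lra.
(* The increments of G telescope, while those of F keep the weights 2^-j handled by
   [dyadic_sum_le]. *)
have tele n : 2 * inner (E `[0, l n] f - E `[0, lambda] f) g <=
    mu * (\sum_(j < n) (F j.+1 - F j) / 2 ^+ j) +
    (lambda * mu)^-1 * (G n - G 0).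
  elim: n => [|n IHn].
    by rewrite big_ord0 /l expr0 mulr1 !subrr inner0l !mulr0 addr0.
  have := step n; rewrite ES addrAC innerDl big_ord_recr/= => stepn.
  lra.
(* As the spectrum is bounded, finitely many blocks exhaust f. *)
have [M EM] := spectral_projection_eventually_id f.
have [n Mn] : exists n, M <= l n.
  exists (Num.bound `|M / lambda|); rewrite /l mulrC -ler_pdivrMr//.
  rewrite (le_trans (ler_norm _))// (le_trans (ltW (archi_boundP _)))//.
  by rewrite -natrX ler_nat ltnW// ltn_expl.
have GT : G n <= `|T g| ^+ 2.
  have mC : measurable (~` `[0, l n] : set (measurableTypeR R)).
    by apply: measurableC.
  rewrite -[in leRHS](pvm_setT pvmE g) -(setUv `[0, l n]) (pvmU pvmE) ?setICr//.
  rewrite (spectral_pythagoras T_inj T_bounded E_spectral) ?setICr//.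
  by rewrite lerDl sqr_ge0.
have G0 : 0 <= G 0 by rewrite sqr_ge0.
have SK := dyadic_sum_le n mu_gt0 mu_lt1 (fun j => sqr_ge0 _) FK.
have := tele n; rewrite {1}/l [E _ f]EM// => /le_trans; apply.
have -> : mu^-1 * (K + `|T g| ^+ 2 / lambda) =
    mu * (K / mu ^+ 2) + (lambda * mu)^-1 * `|T g| ^+ 2.
  by field; rewrite !gt_eqF.
rewrite lerD// ler_wpM2l ?(ltW mu_gt0)//; last by lra.
by rewrite invr_ge0 mulr_ge0 ?(ltW mu_gt0) ?(ltW lambda0).
Qed.

(** Low frequencies contribute 2 N^2 and the tail (N^2 + 1) / mu. General N serves the equivalence,
    N = 1 the explicit constant. *)
Lemma spectral_decay_vsc f N A :
  (forall lambda, 0 < lambda ->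
     `|spectral_projection E lambda f| <= N * kappa lambda) ->
  2 * N ^+ 2 + mu^-1 * (N ^+ 2 + 1) <= A ->
  variational_source_condition T f (fun t => A * psi_of kappa t).
Proof.
move=> fN NA f'; rewrite distrC [`|T f' - _|]distrC -(linearB T).
set g := f - f'.
have [Tg0|Tg0] := eqVneq (T g) 0.
  have -> : g = 0 by apply: T_inj; rewrite Tg0 linear0.
  rewrite linear0 inner0r !normr0 expr0n !mulr0 add0r.
  by rewrite (index_0 (index_function_psi_of kappa_idx)) mulr0.
have Tg_gt0 : 0 < `|T g| ^+ 2 by rewrite exprn_gt0// normr_gt0.
have [s s0 sE] := Theta_sqr_surj kappa_idx (ltW Tg_gt0).
have s_gt0 : 0 < s.
  rewrite lt_def s0 andbT; apply: contraTneq Tg_gt0 => s_eq0.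
  by rewrite sE s_eq0 (index_0 (index_function_Theta kappa_idx)) expr0n ltxx.
rewrite [in leRHS]sE psi_of_Theta//.
have k0 := index_gt0 kappa_idx s_gt0.
have N0 : 0 <= N.
  by rewrite -(pmulr_lge0 _ k0) (le_trans _ (fN _ s_gt0)).
have tail : 2 * inner (f - spectral_projection E s f) g <=
    mu^-1 * (N ^+ 2 * kappa s ^+ 2 + `|T g| ^+ 2 / s).
  apply: spectral_tail_le => // j.
  rewrite (@le_trans _ _ ((N * kappa (s * 2 ^+ j)) ^+ 2))//.
    have sj : 0 < s * 2 ^+ j by rewrite mulr_gt0 ?exprn_gt0.
    rewrite ler_pXn2r ?nnegrE ?fN// mulr_ge0//.
    by rewrite ltW// (index_gt0 kappa_idx).
  rewrite exprMn -[leRHS]mulrA ler_wpM2l ?sqr_ge0//.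
  exact: index_doubling_iter.
have head : 2 * inner (spectral_projection E s f) g <=
    2 * N ^+ 2 * kappa s ^+ 2 + 2^-1 * `|g| ^+ 2.
  apply: (@le_trans _ _ (2 * (N * kappa s * `|g|))).
    rewrite ler_pM2l// (le_trans (inner_le_norm _ _))// ler_wpM2r//.
    exact: fN.
  have := sqr_ge0 (2 * (N * kappa s) - `|g|); nra.
(* The cut-off Theta(s) = |T g| makes the residual term of the tail equal to psi(|T g|^2). *)
have Tgs : `|T g| ^+ 2 / s = kappa s ^+ 2.
  by rewrite sE exprMn sqr_sqrtr// mulrAC mulfV ?mul1r// gt_eqF.
have Ak :
    (2 * N ^+ 2 + mu^-1 * (N ^+ 2 + 1)) * kappa s ^+ 2 <= A * kappa s ^+ 2.
  by rewrite ler_wpM2r// sqr_ge0.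
rewrite Tgs innerBl in tail; move: mu^-1 tail Ak => m tail Ak.
lra.
Qed.

(** * Source norm and finiteness of the constant *)

Lemma source_norm_bound f : (source_norm E kappa f < +oo)%E ->
  exists2 N, source_norm E kappa f = N%:E &
    forall lambda, 0 < lambda ->
      `|spectral_projection E lambda f| <= N * kappa lambda.
Proof.
move=> fin.
have sup_ge lambda : 0 < lambda ->
    (((kappa lambda)^-1 * `|spectral_projection E lambda f|)%:E
      <= source_norm E kappa f)%E.
  move=> lambda0; apply: ereal_sup_ubound; exists lambda => //=.
  by rewrite in_itv/= lambda0.
(* The value at lambda = 1 excludes a supremum of -oo. *)
have fin_sup : source_norm E kappa f \is a fin_num.
  by rewrite fin_real// fin andbT (lt_le_trans _ (sup_ge 1 ltr01))// ltNyr.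
exists (fine (source_norm E kappa f)); first by rewrite fineK.
move=> lambda lambda0; have := sup_ge lambda lambda0.
rewrite -[leRHS]fineK// lee_fin.
by rewrite ler_pdivrMl ?(index_gt0 kappa_idx)// mulrC.
Qed.

Lemma le_source_norm f N :
  (forall lambda, 0 < lambda ->
     `|spectral_projection E lambda f| <= N * kappa lambda) ->
  (source_norm E kappa f <= N%:E)%E.
Proof.
move=> fN; apply: ge_ereal_sup => _ [lambda /= lambda0 <-].
rewrite in_itv/= andbT in lambda0; rewrite lee_fin.
by rewrite ler_pdivrMl ?(index_gt0 kappa_idx)// mulrC fN.
Qed.

(** For t = Theta(s)^2 the quotient is sqrt s / kappa(s), which is nondecreasing because kappa(c
    s)^2 <= c kappa(s)^2 for c >= 1. *)
Lemma sqrt_div_psi_of_le b t : 0 < t -> t <= b ->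
  Num.sqrt t / psi_of kappa t <= Num.sqrt b / psi_of kappa b.
Proof.
move=> t0 tb; have b0 := lt_le_trans t0 tb.
have Theta_idx := index_function_Theta kappa_idx.
have param u : 0 < u -> exists2 s, 0 < s &
    u = Theta kappa s ^+ 2 /\ Num.sqrt u / psi_of kappa u = Num.sqrt s / kappa s.
  move=> u0; have [s s0 sE] := Theta_sqr_surj kappa_idx (ltW u0).
  have s_gt0 : 0 < s.
    rewrite lt_def s0 andbT; apply: contraTneq u0 => s_eq0.
    by rewrite sE s_eq0 (index_0 Theta_idx) expr0n ltxx.
  exists s => //; split=> //; rewrite sE psi_of_Theta// sqrtr_sqr.
  rewrite ger0_norm ?(index_ge0 Theta_idx)// /Theta.
  by field; rewrite gt_eqF// (index_gt0 kappa_idx).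
have [s s0 [sE ->]] := param t t0; have [u u0 [uE ->]] := param b b0.
have su : s <= u.
  rewrite -(index_le Theta_idx) ?in_itv/= ?andbT ?(ltW s0) ?(ltW u0)//.
  rewrite -(@ler_pXn2r _ 2) ?nnegrE ?(index_ge0 Theta_idx) ?(ltW s0) ?(ltW u0)//.
  by rewrite -sE -uE.
have ks := index_gt0 kappa_idx s0; have ku := index_gt0 kappa_idx u0.
rewrite ler_pdivrMr// mulrAC ler_pdivlMr//.
rewrite -(@ler_pXn2r _ 2) ?nnegrE ?mulr_ge0 ?sqrtr_ge0 ?(ltW ks) ?(ltW ku)//.
rewrite !exprMn !sqr_sqrtr ?(ltW s0) ?(ltW u0)//.
have := @index_sublinear _ kappa mu mu_gt0 kappa_decr (u / s) s.
rewrite divfK ?gt_eqF// => /(_ _ s0); rewrite ler_pdivlMr// mul1r => /(_ su).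
by rewrite mulrAC ler_pdivlMr// mulrC.
Qed.

(** By injectivity T does not vanish at f / |f|; boundedness of T makes [sup] an upper bound of the
    set. *)
Lemma opnorm_gt0 f : f != 0 -> 0 < opnorm T.
Proof.
move=> f0; have nf : 0 < `|f| by rewrite normr_gt0.
have [C C0 TC] := pinfty_ex_gt0 ((linear_boundedP T).1 T_bounded).
have Tf : 0 < `|T (`|f|^-1 *: f)|.
  rewrite normr_gt0; apply: contra f0 => /eqP Tf0; apply/eqP.
  have /T_inj/eqP : T (`|f|^-1 *: f) = T 0 by rewrite Tf0 linear0.
  by rewrite scaler_eq0 invr_eq0 normr_eq0 => /orP[]/eqP.
apply: (lt_le_trans Tf); apply: ub_le_sup; last first.
  exists (`|f|^-1 *: f) => //=.
  by rewrite normrZ gtr0_norm ?invr_gt0// mulVf ?gt_eqF.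
exists C => _ [x /= x1 <-]; rewrite (le_trans (TC x))//.
by rewrite ler_piMr// ltW.
Qed.

(** By monotonicity the supremum is attained at the right endpoint b, which is positive because f is
    nonzero. *)
Lemma vsc_constant_fin_num f : f != 0 ->
  exists2 A, A%:E = vsc_constant T kappa mu f & 2 * (1 + mu^-1) <= A.
Proof.
move=> f0; rewrite /vsc_constant; set S := ereal_sup _.
pose b := 4 * opnorm T * `|f|.
have b0 : 0 < b by rewrite !mulr_gt0 ?(opnorm_gt0 f0) ?normr_gt0.
have ratio_ge0 : 0 <= Num.sqrt b / psi_of kappa b.
  have psi_idx := index_function_psi_of kappa_idx.
  by rewrite divr_ge0 ?sqrtr_ge0// (index_ge0 psi_idx)// ltW.
have -> : S = (Num.sqrt b / psi_of kappa b)%:E.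
  apply/eqP; rewrite eq_le; apply/andP; split.
    apply: ge_ereal_sup => _ [t /= + <-]; rewrite in_itv/= => /andP[t0 tb].
    by rewrite lee_fin sqrt_div_psi_of_le.
  by apply: ereal_sup_ubound; exists b => //=; rewrite in_itv/= b0 lexx.
exists (2 * (1 + mu^-1) +
        2 * kappa (opnorm T ^+ 2) * (Num.sqrt b / psi_of kappa b)) => //.
by rewrite lerDl mulr_ge0// mulr_ge0// (index_ge0 kappa_idx)// sqr_ge0.
Qed.

End variational_source_condition.

(** * Equivalence with explicit constants *)

Theorem theorem3p1 (R : realType) (X Y : hilbertType R) (T : {linear X -> Y})
    (E : set (measurableTypeR R) -> X -> X) (kappa : R -> R) (mu : R)
    (fdag : X)
    (T_inj : injective T) (T_bounded : bounded_near T (nbhs 0))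
    (E_spectral : spectral_measure (adjoint T \o T) E)
    (kappa_index : index_function kappa)
    (mu_gt0 : 0 < mu) (mu_lt1 : mu < 1)
    (kappa_decr : {in `]0, +oo[ &,
       nonincreasing_fun (fun t => kappa t ^+ 2 / t `^ (1 - mu))})
    (kappa2_concave : convex_function (`[0, +oo[%classic : set R^o)
       (fun t : R => - (kappa t * kappa t))) :
  [/\ index_function (psi_of kappa),
      (exists2 A : R, 0 < A &
         variational_source_condition T fdag (fun t => A * psi_of kappa t))
      <-> (source_norm E kappa fdag < +oo)%E,
      forall A : R, 0 < A ->
        variational_source_condition T fdag (fun t => A * psi_of kappa t) ->
        forall lambda : R, 0 < lambda ->
          `|spectral_projection E lambda fdag| <=
            Num.sqrt (2 * A / 3) * kappa (2 * A / 3 * lambda) /\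
          Num.sqrt (2 * A / 3) * kappa (2 * A / 3 * lambda) <=
            Num.sqrt (2 * A / 3) * Num.max 1 (Num.sqrt (2 * A / 3)) *
            kappa lambda
    & source_norm E kappa fdag = 1%E ->
      exists A : R, [/\ A%:E = vsc_constant T kappa mu fdag, 0 < A &
        variational_source_condition T fdag (fun t => A * psi_of kappa t)]].
Proof.
have psi_idx := index_function_psi_of kappa_index.
have mui : 0 < mu^-1 by rewrite invr_gt0.
have bound A lambda : 0 < A -> 0 < lambda ->
    variational_source_condition T fdag (fun t => A * psi_of kappa t) ->
    `|spectral_projection E lambda fdag| <=
      Num.sqrt (2 * A / 3) * kappa (2 * A / 3 * lambda) /\
    Num.sqrt (2 * A / 3) * kappa (2 * A / 3 * lambda) <=
      Num.sqrt (2 * A / 3) * Num.max 1 (Num.sqrt (2 * A / 3)) * kappa lambda.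
  move=> A0 lambda0 vsc; split.
    exact: (vsc_spectral_projection_le T_inj T_bounded E_spectral kappa_index).
  rewrite -[leRHS]mulrA ler_wpM2l ?sqrtr_ge0//.
  apply: (index_scale_le kappa_index mu_gt0 kappa_decr) => //.
  by rewrite divr_gt0// mulr_gt0.
split => //.
- split=> [[A A0 vsc]|/(source_norm_bound kappa_index)[N _ fN]].
    apply: le_lt_trans (ltry (Num.sqrt (2 * A / 3) *
                              Num.max 1 (Num.sqrt (2 * A / 3)))).
    apply: (le_source_norm kappa_index) => lambda lambda0.
    by have [/le_trans + H] := bound A lambda A0 lambda0 vsc; apply.
  exists (2 * N ^+ 2 + mu^-1 * (N ^+ 2 + 1)).
    apply: ltr_wpDl; first by rewrite mulr_ge0// sqr_ge0.
    by rewrite mulr_gt0// ltr_wpDl// sqr_ge0.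
  exact: (spectral_decay_vsc T_inj T_bounded E_spectral kappa_index mu_gt0 mu_lt1
    kappa_decr fN).
- by move=> A A0 vsc lambda lambda0; exact: bound.
move=> norm1.
(* Needed for the interval of the supremum to be nonempty. *)
have f0 : fdag != 0.
  apply: contra_eqN norm1 => /eqP ->.
  have : (source_norm E kappa (0%R : X) <= 0%:E)%E.
    apply: (le_source_norm kappa_index) => lambda _.
    rewrite /spectral_projection (pvm_vec0 (spectral_pvm E_spectral))//.
    by rewrite normr0 mul0r.
  by move=> H; rewrite lt_eqF// (le_lt_trans H)// lte_fin.
have [A AE A_ge] :=
  vsc_constant_fin_num T_inj T_bounded kappa_index mu_gt0 kappa_decr f0.
exists A; split => //; first by rewrite (lt_le_trans _ A_ge)// mulr_gt0// addr_gt0.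
have [|N] := @source_norm_bound _ _ E _ kappa_index fdag.
  by rewrite norm1 ltry.
rewrite norm1 => -[<-] fN.
apply: (spectral_decay_vsc T_inj T_bounded E_spectral kappa_index mu_gt0 mu_lt1
  kappa_decr fN).
(* At N = 1 the constant 2 N^2 + (N^2 + 1) / mu is exactly 2 (1 + 1 / mu). *)
by rewrite expr1n (le_trans _ A_ge)//; lra.
Qed.
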